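(* Let $H\in(0,1/2)$ and let $\mathcal{H}^H$ be the Cameron-Martin space associated to fractional Brownian motion on $[0,1]$ with Hurst parameter $H$. Let $1/2<\delta<H+1/2$. Then $\mathcal{H}^H$ is compactly embedded in $W_0^{\delta,2}$, i.e. $\mathcal{H}^H\subset\subset W_0^{\delta,2}$.
   Context: Fractional Brownian motion with Hurst parameter $H$ on $[0,1]$ is the centered continuous Gaussian process with covariance $R_H(s,t)=\tfrac12\left(s^{2H}+t^{2H}-|t-s|^{2H}\right)$; its Cameron-Martin space $\mathcal{H}^H$ is the reproducing kernel Hilbert space of $R_H$, with its Hilbert norm. For $\delta\in(0,1)$ and $p\in(1,\infty)$ and measurable $h:[0,1]\to\mathbb{R}$ set $$|h|_{W^{\delta,p}}=\left(\int\!\!\int_{[0,1]^2}\frac{|h_t-h_s|^p}{|t-s|^{1+\delta p}}\,ds\,dt\right)^{1/p}\in[0,\infty].$$ $W^{\delta,p}$ is the set of $h$ with $|h|_{L^p}+|h|_{W^{\delta,p}}<\infty$. When $\delta>1/p$, its elements are taken to be continuous (continuous representatives), and $W_0^{\delta,p}=\{h\in W^{\delta,p}:h(0)=0\}$, a Banach space under $|\cdot|_{W^{\delta,p}}$. The symbol $\subset\subset$ means compact embedding: the inclusion is well defined and is a compact linear operator. *)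

(* Defs.v *)
From HB Require Import structures.
From mathcomp Require Import all_boot all_order all_algebra sesquilinear.
From mathcomp Require Import all_classical all_reals all_analysis measurable_realfun.
From mathcomp Require Import lra.

Set Implicit Arguments.
Unset Strict Implicit.
Unset Printing Implicit Defensive.

Import Order.TTheory GRing.Theory Num.Theory.
Import numFieldNormedType.Exports.

Local Open Scope classical_set_scope.
Local Open Scope ring_scope.

Definition I01 (R : realType) : set R := `[0, 1].
Arguments I01 R : clear implicits.

Lemma zero_in_I01 (R : realType) : (0 : R) \in I01 R.
Proof. by rewrite inE/= /I01/= in_itv/= lexx ler01. Qed.

Definition I01_0 (R : realType) : I01 R := SigSub (zero_in_I01 R).

(* Covariance of fractional Brownian motion with Hurst parameter H. *)
Definition fbm_cov (R : realType) (H : R) (s t : I01 R) : R :=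
  2^-1 * (val s `^ (2 * H) + val t `^ (2 * H) - `|val t - val s| `^ (2 * H)).

(* A reproducing kernel Hilbert space of K: a Hilbert space of functions on T,
   the function represented by x being rkhs_eval x, which contains the sections
   K(., t) and reproduces through them. For K positive semidefinite, it exists
   and is unique up to an isometry compatible with evaluation
   (Moore-Aronszajn). *)
Record rkhs (R : realType) (T : Type) (K : T -> T -> R) := Rkhs {
  rkhs_space :> completeNormedModType R ;
  rkhs_dot : {dot rkhs_space for idfun} ;
  rkhs_eval : {linear rkhs_space -> (T -> R)} ;
  rkhs_normE : forall x : rkhs_space, `|x| ^+ 2 = rkhs_dot x x ;
  rkhs_eval_inj : injective rkhs_eval ;
  rkhs_reproducing : forall t : T, exists k : rkhs_space,
    (forall s, rkhs_eval k s = K s t) /\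
    (forall x, rkhs_dot x k = rkhs_eval x t) }.

(* Relative compactness in V of the images of bounded sets; this entails
   continuity. *)
Definition compact_operator (R : realType) (U V : normedModType R)
    (f : {linear U -> V}) : Prop :=
  forall A : set U, bounded_set A -> precompact (f @` A).

(* U and V are spaces of functions on T through evU and evV: every function of U
   belongs to V, and the inclusion is a compact linear operator. *)
Definition compactly_embedded (R : realType) (T : Type) (U V : normedModType R)
    (evU : U -> (T -> R)) (evV : V -> (T -> R)) : Prop :=
  exists i : {linear U -> V},
    (forall x, evV (i x) = evU x) /\ compact_operator i.

Section pnorm_on.
Context d (T : measurableType d) (R : realType) (nu : {measure set T -> \bar R}).
Variables (D : set T) (p : R).
Hypotheses (mD : measurable D) (p1 : 1 <= p).
Implicit Types f g : T -> R.
Local Open Scope ereal_scope.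

Let pnorm_on f : \bar R := (\int[nu]_(x in D) (`|f x| `^ p)%:E) `^ p^-1.

Let p0 : (p != 0)%R.
Proof. by rewrite gt_eqF// (lt_le_trans ltr01). Qed.

Let pnorm_onE f : pnorm_on f = 'N[nu]_p%:E[EFin \o (f \_ D)%R].
Proof.
rewrite unlock /pnorm_on integral_mkcond; congr (_ `^ _).
apply: eq_integral => x _ /=; rewrite !patchE.
by case: ifPn => //= _; rewrite normr0 powR0.
Qed.

Lemma pnorm_on_ge0 f : 0 <= pnorm_on f.
Proof. exact: poweR_ge0. Qed.

Lemma pnorm_on0 : pnorm_on (fun=> 0%R) = 0.
Proof.
rewrite /pnorm_on; under eq_integral do rewrite normr0 powR0//.
by rewrite integral0 poweR0r// invr_eq0.
Qed.

Lemma pnorm_onD f g : measurable_fun D f -> measurable_fun D g ->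
  pnorm_on (fun x => f x + g x)%R <= pnorm_on f + pnorm_on g.
Proof.
move=> mf mg; rewrite !pnorm_onE.
rewrite (_ : _ \_ D = (f \_ D) \+ (g \_ D))%R.
  apply: minkowski_EFin => //; first by apply/(measurable_restrictT _ mD).
  by apply/(measurable_restrictT _ mD).
by apply/funext => x /=; rewrite !patchE; case: ifP => //; rewrite addr0.
Qed.

Lemma pnorm_onZ f (a : R) : measurable_fun D f ->
  pnorm_on (fun x => a * f x)%R = `|a|%:E * pnorm_on f.
Proof.
move=> mf; rewrite /pnorm_on.
under eq_integral do rewrite normrM powRM// EFinM.
have mfp : measurable_fun D (fun x => (`|f x| `^ p)%R).
  apply: (@measurableT_comp _ _ _ _ _ _ (@powR R ^~ p)) => //.
  exact: measurableT_comp.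
rewrite ge0_integralZl//; last exact/measurable_EFinP.
rewrite poweRM ?lee_fin ?powR_ge0//; last first.
  by apply: integral_ge0 => x _; rewrite lee_fin powR_ge0.
by rewrite poweR_EFin -powRrM mulfV// powRr1.
Qed.

Lemma pnorm_on_eq0 f : measurable_fun D f -> pnorm_on f = 0 ->
  nu.-negligible [set x | D x /\ f x != 0%R].
Proof.
move=> mf; rewrite pnorm_onE => /Lnorm_eq0_eq0 h.
have {h} : EFin \o (f \_ D)%R = \0 %[ae nu].
  apply: h; last by rewrite lte_fin (lt_le_trans ltr01).
  by apply/measurable_EFinP/(measurable_restrictT _ mD).
apply: negligibleS => x /= [Dx fx] /(_ I) [].
by rewrite patchE mem_set//; exact/eqP.
Qed.

End pnorm_on.

(* d stands for delta. *)
Section Slobodeckij.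
Context {R : realType}.
Implicit Types (p d : R) (h : I01 R -> R).
Local Notation I := (I01 R).
Local Notation mu := (@lebesgue_measure R).

(* Extension by 0 outside [0, 1]; only its values on [0, 1] matter below. *)
Definition ext0 h : R -> R := 'valL_(0 : R) h.

Definition Lp_norm p h : \bar R :=
  ((\int[mu]_(t in I) (`|ext0 h t| `^ p)%:E) `^ p^-1)%E.

(* On the diagonal, a null set, the integrand is 0 because 0^-1 = 0. *)
Definition W_norm d p h : \bar R :=
  ((\int[mu \x mu]_(z in I `*` I)
     (`|ext0 h z.2 - ext0 h z.1| `^ p / `|z.2 - z.1| `^ (1 + d * p))%:E)
   `^ p^-1)%E.

Definition W_set d p : set (I01 R -> R) :=
  [set h | measurable_fun I (ext0 h) /\ (Lp_norm p h + W_norm d p h < +oo)%E].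

(* The pointwise continuity condition fixes the continuous representative. *)
Definition W0_set d p : set (I01 R -> R) :=
  [set h | [/\ W_set d p h, continuous h & h (I01_0 R) = 0]].

Section properties.
Variables d p : R.
Hypothesis p1 : 1 <= p.

Lemma ext0D f g t : ext0 (f + g) t = ext0 f t + ext0 g t.
Proof. by rewrite /ext0 /valL_/=; case: ('oinv_set_val _) => //=; rewrite addr0. Qed.

Lemma ext0Z (a : R) f t : ext0 (a *: f) t = a * ext0 f t.
Proof. by rewrite /ext0 /valL_/=; case: ('oinv_set_val _) => //=; rewrite mulr0. Qed.

Lemma ext0E f (t : I01 R) : ext0 f (val t) = f t.
Proof. by rewrite /ext0 /= oinv_set_val valK. Qed.

Let w (z : R * R) : R := (`|z.2 - z.1| `^ (1 + d * p))^-1.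
Let F h (z : R * R) : R := (ext0 h z.2 - ext0 h z.1) * w z `^ p^-1.

Let mI : measurable (I : set R).
Proof. by rewrite /I01. Qed.

Let mII : measurable (I `*` I).
Proof. exact: measurableX. Qed.

Let p0 : p != 0.
Proof. by rewrite gt_eqF// (lt_le_trans ltr01). Qed.

Let mw : measurable_fun setT w.
Proof.
rewrite /w; under eq_fun do rewrite -powRN.
apply: (@measurableT_comp _ _ _ _ _ _ (@powR R ^~ (- (1 + d * p)))) => //.
apply: measurableT_comp => //.
exact: measurable_funB.
Qed.

Let mF h : measurable_fun I (ext0 h) -> measurable_fun (I `*` I) (F h).
Proof.
move=> mh; apply: measurable_funM; last first.
  apply: measurable_funTS.
  exact: (@measurableT_comp _ _ _ _ _ _ (@powR R ^~ p^-1)).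
apply: measurable_funB.
- apply: (measurable_comp mI _ mh) => [_ [z [_ ?]] <-//|].
  exact: measurable_funTS.
- apply: (measurable_comp mI _ mh) => [_ [z [? _]] <-//|].
  exact: measurable_funTS.
Qed.

Let W_normE h : W_norm d p h =
  ((\int[mu \x mu]_(z in I `*` I) (`|F h z| `^ p)%:E) `^ p^-1)%E.
Proof.
rewrite /W_norm; congr (_ `^ _)%E; apply: eq_integral => z _; congr EFin.
have w0 : 0 <= w z by rewrite /w invr_ge0 powR_ge0.
rewrite /F normrM powRM// (ger0_norm (powR_ge0 _ _)) -powRrM mulVf//.
by rewrite powRr1.
Qed.

Lemma W_norm_ge0 h : (0 <= W_norm d p h)%E.
Proof. exact: poweR_ge0. Qed.

Lemma Lp_norm_ge0 h : (0 <= Lp_norm p h)%E.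
Proof. exact: poweR_ge0. Qed.

Lemma W_normD f g : measurable_fun I (ext0 f) -> measurable_fun I (ext0 g) ->
  (W_norm d p (f + g)%R <= W_norm d p f + W_norm d p g)%E.
Proof.
move=> mf mg; rewrite !W_normE.
have -> : F (f + g) = fun z => F f z + F g z.
  by apply/funext => z; rewrite /F !ext0D opprD addrACA mulrDl.
exact: (pnorm_onD (mu \x mu)%E mII p1 (mF mf) (mF mg)).
Qed.

Lemma W_normZ (a : R) f : measurable_fun I (ext0 f) ->
  W_norm d p (a *: f) = (`|a|%:E * W_norm d p f)%E.
Proof.
move=> mf; rewrite !W_normE.
have -> : F (a *: f) = fun z => a * F f z.
  by apply/funext => z; rewrite /F !ext0Z -mulrBr -mulrA.
exact: (pnorm_onZ (mu \x mu)%E mII p1 a (mF mf)).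
Qed.

Lemma Lp_normD f g : measurable_fun I (ext0 f) -> measurable_fun I (ext0 g) ->
  (Lp_norm p (f + g)%R <= Lp_norm p f + Lp_norm p g)%E.
Proof.
move=> mf mg; rewrite /Lp_norm.
have -> : ext0 (f + g) = fun t => ext0 f t + ext0 g t.
  by apply/funext => t; rewrite ext0D.
exact: (pnorm_onD mu mI p1 mf mg).
Qed.

Lemma Lp_normZ (a : R) f : measurable_fun I (ext0 f) ->
  Lp_norm p (a *: f) = (`|a|%:E * Lp_norm p f)%E.
Proof.
move=> mf; rewrite /Lp_norm.
have -> : ext0 (a *: f) = fun t => a * ext0 f t.
  by apply/funext => t; rewrite ext0Z.
exact: (pnorm_onZ mu mI p1 a mf).
Qed.

Lemma W_set_fin f : W_set d p f -> W_norm d p f \is a fin_num.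
Proof.
case=> _ h; rewrite ge0_fin_numE ?W_norm_ge0//.
by apply: le_lt_trans h; rewrite leeDr// Lp_norm_ge0.
Qed.

Lemma W_set0 : W_set d p 0.
Proof.
have e0 t : ext0 (0 : I01 R -> R) t = 0.
  by rewrite -(scale0r (0 : I01 R -> R)) ext0Z mul0r.
have m0 : measurable_fun I (ext0 (0 : I01 R -> R)).
  by rewrite (_ : ext0 _ = cst 0)//; apply/funext => t; exact: e0.
split => //.
rewrite -(scale0r (0 : I01 R -> R)) W_normZ// Lp_normZ// normr0 !mul0e.
by rewrite adde0 ltry.
Qed.

Lemma W_setD f g : W_set d p f -> W_set d p g -> W_set d p (f + g).
Proof.
move=> [mf ff] [mg gf]; split.
  rewrite (_ : ext0 _ = ext0 f \+ ext0 g); last first.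
    by apply/funext => t; rewrite ext0D.
  exact: measurable_funD.
apply: le_lt_trans (leeD (Lp_normD mf mg) (W_normD mf mg)) _.
move: ff gf; move: (Lp_norm p f) (Lp_norm p g) (W_norm d p f) (W_norm d p g).
by move=> a b a' b' ? ?; rewrite addeACA lte_add_pinfty.
Qed.

Lemma W_setZ (a : R) f : W_set d p f -> W_set d p (a *: f).
Proof.
move=> [mf ff]; split.
  rewrite (_ : ext0 _ = fun t => a * ext0 f t); last first.
    by apply/funext => t; rewrite ext0Z.
  exact: measurable_funM.
rewrite (Lp_normZ a mf) (W_normZ a mf).
move: ff (W_norm_ge0 f) (Lp_norm_ge0 f); move: (Lp_norm p f) (W_norm d p f).
by move=> x y ? ? ?; rewrite -ge0_muleDr// lte_mul_pinfty// adde_ge0.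
Qed.

Lemma W0_set_submod : submod_closed (mem (W0_set d p : set (I01 R -> R))).
Proof.
split; first by rewrite inE; split => //; [exact: W_set0|exact: cst_continuous].
move=> a f g /[!inE] -[Wf cf f0] [Wg cg g0]; split.
- exact: (W_setD (W_setZ a Wf) Wg).
- move=> t; apply: (@continuousD _ _ _ (fun t => a * f t) g); last exact: cg.
  by apply: continuousM; [exact: cst_continuous|exact: cf].
- by rewrite /= !fctE f0 g0 scaler0 addr0.
Qed.


Lemma W_norm_eq0 h : W0_set d p h -> W_norm d p h = 0%E -> h = 0.
Proof.
move=> [[mh _] ch h0]; rewrite W_normE => hW.
have N := pnorm_on_eq0 (nu := (mu \x mu)%E) mII p1 (mF mh) hW.
apply/funext => a; apply/eqP; apply: contraT => /= ha0.
have e0 : 0 < `|h a| / 2 by rewrite divr_gt0// normr_gt0.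
have near b : exists2 r : R, 0 < r & forall t : I01 R,
    `|val b - val t| < r -> `|h b - h t| < `|h a| / 2.
  have := ch b => /cvgrPdist_lt /(_ _ e0) /nbhs_ballP[r r0 br].
  by exists r => // t bt; exact: br.
have {near} itv b : exists uv : R * R, [/\ uv.1 < uv.2, `[uv.1, uv.2] `<=` I &
    forall t : I01 R, uv.1 <= val t <= uv.2 -> `|h b - h t| < `|h a| / 2].
  have [r r0 br] := near b.
  have : I (val b) by exact: set_mem (valP b).
  rewrite /I01/= in_itv/= => /andP[b0 b1].
  exists (Num.max 0 (val b - r / 2), Num.min 1 (val b + r / 2)).
  split => /=.
  - rewrite gt_max !lt_min; apply/and3P; split; lra.
  - move=> t /=; rewrite !in_itv/= ge_max le_min; lra.
  - move=> t; rewrite ge_max le_min => tb; apply: br; rewrite ltr_norml.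
    have E (x y : R) : [&& (0 <= x) && (y - r / 2 <= x), x <= 1 & x <= y + r / 2] ->
      - r < y - x < r by lra.
    exact: E tb.
have [[a1 a2] /= [a12 aI ha]] := itv a.
have [[b1 b2] /= [b12 bI hb]] := itv (I01_0 R).
have : (mu \x mu)%E.-negligible (`[b1, b2] `*` `[a1, a2]).
  apply: negligibleS N => -[s t] /= [sb ta].
  have sI := bI _ sb; have tI := aI _ ta; split => //.
  pose s' : I01 R := SigSub (mem_set sI); pose t' : I01 R := SigSub (mem_set tI).
  have hs : `|h (I01_0 R) - h s'| < `|h a| / 2 by apply: hb; move: sb; rewrite in_itv.
  have ht : `|h a - h t'| < `|h a| / 2 by apply: ha; move: ta; rewrite in_itv.
  have st : h s' != h t'.
    apply/eqP => st; move: hs ht; rewrite h0 sub0r normrN st => hs ht.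
    suff : `|h a| < `|h a| by rewrite ltxx.
    rewrite {2}(splitr `|h a|) -{1}(subrK (h t') (h a)).
    by apply: (le_lt_trans (ler_normD _ _)); exact: ltrD.
  rewrite /F /= (ext0E h s') (ext0E h t') mulf_neq0//.
    by rewrite subr_eq0 eq_sym.
  have st' : s != t.
    by apply: contra st => /eqP st; apply/eqP; congr h; exact: val_inj.
  by rewrite gt_eqF// !powR_gt0// invr_gt0 powR_gt0// normr_gt0 subr_eq0 eq_sym.
rewrite negligibleP; last exact: measurableX.
rewrite [X in X = _]product_measure1E//= !lebesgue_measure_itv/= !lte_fin a12 b12.
by rewrite -EFinD -EFinM => -[] /eqP; rewrite mulf_eq0 !subr_eq0 !gt_eqF.
Qed.

End properties.

End Slobodeckij.

Section W0_type.
Context {R : realType} (d p : R) (p1 : 1 < p).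

(* The argument p1 only serves to make W0 below a normed space. *)
Definition W0_pred of 1 < p : {pred I01 R -> R} := mem (W0_set d p).

Lemma W0_pred_submod : submod_closed (W0_pred p1).
Proof. exact: W0_set_submod (ltW p1). Qed.

HB.instance Definition _ :=
  GRing.isSubmodClosed.Build R (I01 R -> R) (W0_pred p1) W0_pred_submod.

Record W0 := MkW0 { W0_fun :> I01 R -> R ; _ : W0_fun \in W0_pred p1 }.

HB.instance Definition _ := [isSub for W0_fun].
HB.instance Definition _ := [Choice of W0 by <:].
HB.instance Definition _ := [SubChoice_isSubLmodule of W0 by <:].

Lemma W0P (h : W0) : W0_set d p h.
Proof. by have := valP h; rewrite /W0_pred inE. Qed.

Definition W0_norm (h : W0) : R := fine (W_norm d p h).

Lemma W0_normE (h : W0) : (W0_norm h)%:E = W_norm d p h.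
Proof. by rewrite fineK// W_set_fin//; have [] := W0P h. Qed.

Lemma ler_W0_normD (f g : W0) : W0_norm (f + g) <= W0_norm f + W0_norm g.
Proof.
have [[mf _] _ _] := W0P f; have [[mg _] _ _] := W0P g.
have := W_normD d (ltW p1) mf mg.
rewrite -(W0_normE f) -(W0_normE g) -EFinD -lee_fin.
by apply: le_trans; rewrite W0_normE.
Qed.

Lemma W0_normZ (a : R) (f : W0) : W0_norm (a *: f) = `|a| * W0_norm f.
Proof.
have [[mf _] _ _] := W0P f; apply/EFin_inj.
rewrite EFinM; apply: (etrans (W0_normE _)).
apply: (etrans (W_normZ d (ltW p1) a mf)).
by congr (_ * _)%E; rewrite W0_normE.
Qed.

Lemma W0_norm_eq0 (f : W0) : W0_norm f = 0 -> f = 0.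
Proof.
move=> f0; apply/val_inj/(W_norm_eq0 (ltW p1) (W0P f)).
by rewrite -W0_normE f0.
Qed.

HB.instance Definition _ := @Lmodule_isNormed.Build R W0
  W0_norm ler_W0_normD W0_normZ W0_norm_eq0.

Lemma W0_normrE (h : W0) : `|h|%:E = W_norm d p h.
Proof. exact: W0_normE. Qed.

End W0_type.

Lemma lt1_2 (R : realType) : 1 < 2 :> R.
Proof. by rewrite ltr1n. Qed.

(* Main.v *)
(* For h in the Cameron-Martin space, the increments of h along a grid of mesh
   1/N are inner products of h with the increments of the covariance kernel. The
   Schur test bounds the sum of the squares of the increments of lag k/N by
   |h|^2 times the maximal absolute row sum of their Gram matrix; for H < 1/2
   its entries are second differences of the concave function x^(2H), so these
   row sums telescope to O((k/N)^(2H) k). Weighting by the lag and letting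
   N tend to infinity (Fatou) bounds the W^{d,2} seminorm by |h| for every
   d < H + 1/2. For compactness, the functions dominated by the kernel, which
   include the image of a ball, form a set that is closed in the topology of
   pointwise convergence, hence compact by Tychonoff; it is equicontinuous and
   bounded in W^{d',2} for some d' > d, so on it pointwise convergence implies
   uniform convergence and, by interpolation, convergence in W^{d,2}. *)
From HB Require Import structures.
Require Import Defs.
From mathcomp Require Import all_boot all_order all_algebra sesquilinear.
From mathcomp Require Import all_classical all_reals all_analysis.
From mathcomp Require Import measurable_realfun ring lra zify.

Import Order.TTheory GRing.Theory Num.Theory.
Import numFieldNormedType.Exports.

Set Implicit Arguments.
Unset Strict Implicit.
Unset Printing Implicit Defensive.

Local Open Scope classical_set_scope.
Local Open Scope ring_scope.

(** * Concavity inequalities for powers and sums of second differences *)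

Section PowerInequalities.
Context {R : realType}.
Implicit Types x y g : R.

(** Young's inequality for x^g and 1, with conjugate exponents 1/g and 1/(1-g). *)
Lemma powR_le_tangent g x : 0 < g < 1 -> 0 <= x -> x `^ g <= 1 + g * (x - 1).
Proof.
move=> /andP[g0 g1] x0.
have p0 : 0 < g^-1 by rewrite invr_gt0.
have q0 : 0 < (1 - g)^-1 by rewrite invr_gt0 subr_gt0.
have e : g^-1^-1 + (1 - g)^-1^-1 = 1 by rewrite !invrK addrC subrK.
have := conjugate_powR (powR_ge0 x g) ler01 p0 q0 e.
rewrite mulr1 powR1 -powRrM divff ?gt_eqF// powRr1// !invrK.
by lra.
Qed.

(** After factoring out x^g, add the tangent bounds at 1 + y/x and 1 - y/x: their linear terms
    cancel. *)
Lemma powR_second_diff_le0 g x y : 0 < g < 1 -> 0 <= y <= x ->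
  (x + y) `^ g + (x - y) `^ g <= 2 * x `^ g.
Proof.
move=> g01 /andP[y0 yx].
have [x0|] := ltP 0 x; last first.
  move=> x0; have -> : x = 0 by apply/eqP; rewrite eq_le x0 (le_trans y0).
  have -> : y = 0 by apply/eqP; rewrite eq_le y0 (le_trans yx).
  by rewrite subrr addr0 powR0 ?mulr0 ?addr0// gt_eqF//; case/andP: g01.
have E z : x + z = x * (1 + z / x) by rewrite mulrDr mulr1 mulrC divfK ?gt_eqF.
have yx1 : y / x <= 1 by rewrite ler_pdivrMr ?mul1r.
have yx0 : 0 <= y / x by rewrite divr_ge0// ltW.
rewrite (E y) (E (- y)) mulNr !powRM//; [|lra..].
have h1 := @powR_le_tangent g (1 + y / x) g01 ltac:(lra).
have h2 := @powR_le_tangent g (1 - y / x) g01 ltac:(lra).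
rewrite -mulrDr mulrC ler_wpM2r ?powR_ge0//.
by rewrite (le_trans (lerD h1 h2))//; lra.
Qed.

(** A ratio z/(x+y) in [0, 1] is at most its g-th power; add the cases z = x and z = y. *)
Lemma powR_subadd g x y : 0 < g < 1 -> 0 <= x -> 0 <= y ->
  (x + y) `^ g <= x `^ g + y `^ g.
Proof.
move=> /andP[g0 g1] x0 y0.
have [->|xy0] := eqVneq (x + y) 0.
  by rewrite powR0 ?gt_eqF// addr_ge0// powR_ge0.
have xyp : 0 < x + y by rewrite lt_neqAle eq_sym xy0 addr_ge0.
have E z : 0 <= z -> z <= x + y -> (x + y) `^ g * (z / (x + y)) <= z `^ g.
  rewrite le_eqVlt => /predU1P[<- _|z0 zxy]; first by rewrite mul0r mulr0 powR_ge0.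
  have zp : 0 < z / (x + y) by rewrite divr_gt0.
  rewrite mulrC -[in leRHS](divfK xy0 z) powRM; [|exact: ltW..].
  rewrite ler_wpM2r ?powR_ge0// ger1_powR ?(ltW g1)// zp/=.
  by rewrite ler_pdivrMr// mul1r.
have h1 := E x x0 ltac:(lra); have h2 := E y y0 ltac:(lra).
apply: le_trans (lerD h1 h2).
by rewrite -mulrDr -mulrDl divff// mulr1.
Qed.

(** Induction on n. The tangent bound evaluated at 1 - 1/(n+1) gives n^(1-b) <= (n+1)^(1-b) (1 -
    (1-b)/(n+1)), so the new term (n+1)^(-b) is at most the increment of the right side. *)
Lemma sum_powRN_le (b : R) n : 0 < b < 1 ->
  \sum_(k < n) k.+1%:R `^ (- b) <= n%:R `^ (1 - b) / (1 - b).
Proof.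
move=> /andP[b0 b1].
have g01 : 0 < 1 - b < 1 by lra.
have g0 : 0 < 1 - b by lra.
elim: n => [|n IH]; first by rewrite big_ord0 divr_ge0 ?powR_ge0// ltW.
rewrite big_ord_recr/= (le_trans (lerD IH (lexx _)))//.
have N0 : 0 < n.+1%:R :> R by [].
have E : n%:R = n.+1%:R * (1 - n.+1%:R^-1) :> R.
  by rewrite mulrBr mulr1 divff// -natr1 addrK.
have iN : n.+1%:R^-1 <= 1 :> R by rewrite invf_le1// ler1n.
rewrite [in leLHS]E powRM ?subr_ge0//.
have h := @powR_le_tangent (1 - b) (1 - n.+1%:R^-1) g01.
move: h; rewrite subr_ge0 => /(_ iN) h.
have -> : n.+1%:R `^ (- b) = n.+1%:R `^ (1 - b) * n.+1%:R^-1.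
  rewrite -(powR_inv1 (ltW N0)) -powRD ?pnatr_eq0 ?implybT//.
  by congr (_ `^ _); ring.
rewrite ler_pdivlMr// mulrDl divfK ?gt_eqF// -mulrA -mulrDr ler_piMr ?powR_ge0//.
by move: (n.+1%:R^-1) h => u h; rewrite (le_trans (lerD h (lexx _)))//; lra.
Qed.

Let a g (k l : nat) : R := (l + k)%:R `^ g - l%:R `^ g.

Let a_ge0 g k l : 0 < g < 1 -> 0 <= a g k l.
Proof.
move=> /andP[g0 _]; 
by rewrite subr_ge0 ge0_ler_powR ?(ltW g0) ?nnegrE ?ler_nat ?leq_addr.
Qed.

Let a_le g k l : 0 < g < 1 -> a g k l <= k%:R `^ g.
Proof. by move=> g01; rewrite lerBlDl natrD powR_subadd. Qed.

(** Cancellation leaves the first k values of [a], each at most k^g, minus the k values from m on,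
    which are nonnegative. *)
Let telescope g (k m : nat) : 0 < g < 1 ->
  \sum_(l < m) (a g k l - a g k (l + k)%N) <= k%:R * k%:R `^ g.
Proof.
move=> g01.
have -> : \sum_(l < m) (a g k l - a g k (l + k)%N) =
    \sum_(l < k) a g k l - \sum_(l < k) a g k (m + l)%N.
  rewrite sumrB; apply/eqP.
  rewrite subr_eq addrAC eq_sym subr_eq eq_sym.
  under [X in _ + X == _]eq_bigr do rewrite addnC.
  rewrite -(big_mkord xpredT (a g k)) -(big_mkord xpredT (fun l => a g k (l + m)%N)).
  rewrite -(big_mkord xpredT (a g k)) -(big_mkord xpredT (fun l => a g k (l + k)%N)).
  have sh p q : \sum_(0 <= l < q) a g k (l + p)%N = \sum_(p <= l < q + p) a g k l.
    by rewrite -[in RHS](add0n p) big_addn addnK.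
  by rewrite !sh -!big_cat_nat ?leq_addl// addnC.
rewrite (@le_trans _ _ (\sum_(l < k) a g k l))//.
  by rewrite gerBl sumr_ge0// => l _; exact: a_ge0.
rewrite (@le_trans _ _ (\sum_(l < k) k%:R `^ g))//.
  by apply: ler_sum => l _; exact: a_le.
by rewrite sumr_const card_ord -[leLHS]mulr_natl.
Qed.

(** For g = 2H, the covariance of two increments of lag k on the integer grid whose starting points
    are l apart (autocovariance of fractional Gaussian noise). *)
Definition second_diff g (k l : nat) : R :=
  2^-1 * ((l + k)%:R `^ g + `|l%:R - k%:R| `^ g - 2 * l%:R `^ g).

(* For l >= k concavity makes the second differences nonpositive, so the sum of
   their absolute values telescopes. *)
Lemma sum_second_diff_le g (k m : nat) : 0 < g < 1 ->
  \sum_(l < m) `|second_diff g k l| <= 2 * (k%:R * k%:R `^ g).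
Proof.
move=> g01.
have sd_small l : (l < k)%N -> `|second_diff g k l| <= k%:R `^ g.
  move=> lk.
  have := a_ge0 k l g01; have := a_le k l g01.
  have e : `|l%:R - k%:R| = (k - l)%:R :> R.
    by rewrite distrC natrB ?ger0_norm ?subr_ge0 ?ler_nat// ltnW.
  have i1 : (k - l)%:R `^ g <= k%:R `^ g.
    by rewrite ge0_ler_powR ?nnegrE ?ler_nat ?leq_subr//; case/andP: g01 => /ltW.
  have i2 : l%:R `^ g <= k%:R `^ g.
    by rewrite ge0_ler_powR ?nnegrE ?ler_nat ?(ltnW lk)//; case/andP: g01 => /ltW.
  have i3 := powR_ge0 (k - l)%:R g; have i4 := powR_ge0 l%:R g.
  by rewrite /second_diff /a e ler_norml => *; apply/andP; split; lra.
have sd_big l : `|second_diff g k (l + k)| = 2^-1 * (a g k l - a g k (l + k)).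
  have := @powR_second_diff_le0 g (l + k)%:R k%:R g01.
  rewrite natrD addrK ler0n lerDr ler0n => /(_ isT) h.
  rewrite /second_diff /a !natrD addrK normr_nat ler0_norm; first lra.
  by rewrite pmulr_rle0// subr_le0.
(* Enlarging the range to k + m allows splitting at l = k even when m < k. *)
rewrite (@le_trans _ _ (\sum_(l < k + m) `|second_diff g k l|))//.
  rewrite -!(big_mkord xpredT (fun l => `|second_diff g k l|)).
  rewrite [leRHS](@big_cat_nat _ _ _ m)/= ?leq_addl//.
  by rewrite lerDl sumr_ge0.
rewrite big_split_ord/=.
under [X in _ + X]eq_bigr do rewrite addnC sd_big.
rewrite -mulr_sumr.
have i1 : \sum_(l < k) `|second_diff g k l| <= k%:R * k%:R `^ g.
  rewrite (@le_trans _ _ (\sum_(l < k) k%:R `^ g))//.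
    by apply: ler_sum => l _; exact: sd_small.
  by rewrite sumr_const card_ord -[leLHS]mulr_natl.
have i2 := telescope k m g01.
have i3 : 0 <= k%:R * k%:R `^ g :> R by rewrite mulr_ge0 ?powR_ge0.
by lra.
Qed.

End PowerInequalities.

(** * Schur test and rearrangements of double sums *)

Section FiniteSums.
Context {R : realType}.

(** With S the sum of squares, 2|a_i a_j| <= a_i^2 + a_j^2 and the symmetry of G bound the quadratic
    form by M S. The last hypothesis then gives S^2 <= C^2 M S, and S cancels. *)
Lemma schur_test n (C M : R) (a : 'I_n -> R) (G : 'I_n -> 'I_n -> R) :
  0 <= M -> (forall i j, G i j = G j i) ->
  (forall i, \sum_(j < n) `|G i j| <= M) ->
  (\sum_(i < n) a i ^+ 2) ^+ 2 <=
    C ^+ 2 * \sum_(i < n) \sum_(j < n) a i * a j * G i j ->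
  \sum_(i < n) a i ^+ 2 <= C ^+ 2 * M.
Proof.
move=> M0 symG GM; set S := \sum_(i < n) _ ^+ 2 => hS.
have S0 : 0 <= S by apply: sumr_ge0 => i _; exact: sqr_ge0.
have [S_gt0|] := ltP 0 S; last first.
  by move=> /le_trans; apply; rewrite mulr_ge0 ?sqr_ge0.
have half : \sum_(i < n) \sum_(j < n) a i ^+ 2 * `|G i j| <= M * S.
  rewrite mulr_sumr; apply: ler_sum => i _.
  by rewrite -mulr_sumr mulrC ler_wpM2r ?sqr_ge0.
have Q : \sum_(i < n) \sum_(j < n) a i * a j * G i j <= M * S.
  apply: (@le_trans _ _ (\sum_(i < n) \sum_(j < n)
      (2^-1 * (a i ^+ 2 * `|G i j|) + 2^-1 * (a j ^+ 2 * `|G j i|)))).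
    apply: ler_sum => i _; apply: ler_sum => j _.
    rewrite (symG j i) -mulrDr -mulrDl mulrA.
    apply: le_trans (ler_norm _) _; rewrite normrM ler_wpM2r//.
    have := sqr_ge0 (`|a i| - `|a j|).
    by rewrite normrM sqrrB !real_normK ?num_real//; lra.
  have scale (F : 'I_n -> 'I_n -> R) : \sum_(i < n) \sum_(j < n) 2^-1 * F i j =
      2^-1 * \sum_(i < n) \sum_(j < n) F i j.
    by rewrite mulr_sumr; apply: eq_bigr => i _; rewrite mulr_sumr.
  under eq_bigr do rewrite big_split/=.
  by rewrite big_split/= !scale [X in _ + 2^-1 * X]exchange_big/=; lra.
rewrite -(@ler_pM2r _ S)// -expr2 (le_trans hS)// -[leRHS]mulrA.
by rewrite ler_wpM2l ?sqr_ge0.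
Qed.

(** With truncated subtraction, [i - j + (j - i)] is |i - j|; each distance occurs at most once on
    either side of i. *)
Lemma sum_dist_le n i (F : nat -> R) : (i < n)%N -> (forall l, 0 <= F l) ->
  \sum_(j < n) F (i - j + (j - i))%N <= 2 * \sum_(l < n) F l.
Proof.
move=> lt_in F0.
have mono m : (m <= n)%N -> \sum_(0 <= l < m) F l <= \sum_(0 <= l < n) F l.
  move=> mn; rewrite [leRHS](@big_cat_nat _ _ _ m)//= lerDl.
  by apply: sumr_ge0.
rewrite -(big_mkord xpredT (fun j => F (i - j + (j - i))%N)) -(big_mkord xpredT).
rewrite (@big_cat_nat _ _ _ i)/= ?(ltnW lt_in)//.
rewrite [leRHS]mulr_natl mulr2n lerD//.
  have -> : \sum_(0 <= j < i) F (i - j + (j - i))%N = \sum_(0 <= l < i) F l.+1.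
    rewrite big_nat_rev/=; apply: eq_big_nat => l /andP[_ li].
    by congr F; lia.
  apply: le_trans (mono i.+1 lt_in).
  by rewrite [leRHS]big_nat_recl//= lerDr.
apply: le_trans (mono (n - i)%N (leq_subr _ _)).
rewrite -{1}(add0n i) big_addn; apply: ler_sum_nat => l /andP[_ li].
by rewrite le_eqVlt (_ : (_ + _)%N = l) ?eqxx//; lia.
Qed.

(** Groups a double sum by lag. In the induction, the new row and column agree by symmetry, and each
    diagonal k gains one entry, F (n-k) n. *)
Lemma sum_sym_diag n (F : nat -> nat -> R) :
  (forall i j, F i j = F j i) -> (forall i, F i i = 0) ->
  \sum_(i < n) \sum_(j < n) F i j =
  2 * \sum_(k < n) \sum_(i < n - k) F i (i + k)%N.
Proof.
move=> symF F0; elim: n => [|n IH]; first by rewrite !big_ord0 mulr0.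
rewrite big_ord_recr/=; under eq_bigr do rewrite big_ord_recr/=.
rewrite big_split/= IH big_ord_recr/= F0 addr0.
under [X in _ + X]eq_bigr do rewrite symF.
rewrite -addrA -mulr2n -[X in _ + X]mulr_natl -mulrDr; congr (_ * _).
rewrite [in RHS]big_ord_recr/= subSn// subnn big_ord_recr big_ord0/= add0r.
have E : \sum_(k < n) \sum_(i < n.+1 - k) F i (i + k)%N =
    \sum_(k < n) (\sum_(i < n - k) F i (i + k)%N + F (n - k)%N n).
  apply: eq_bigr => k _; have kn := ltn_ord k.
  by rewrite subSn ?(ltnW kn)// big_ord_recr/= subnK ?(ltnW kn).
rewrite E big_split/= -addrA; congr (_ + _).
have -> : \sum_(k < n) F (n - k)%N n + F 0 (0 + n)%N = \sum_(k < n.+1) F (n - k)%N n.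
  by rewrite big_ord_recr/= subnn add0n.
rewrite -(big_mkord xpredT (fun i => F i n)).
rewrite -(big_mkord xpredT (fun i => F (n - i)%N n)) [RHS]big_nat_rev/=.
rewrite big_nat_recr//= add0n subnn subn0 F0 addr0.
by apply: eq_big_nat => i /andP[_ li]; congr F; lia.
Qed.

End FiniteSums.

(** * Cameron-Martin balls and their increments along grids *)

Section CameronMartinBall.
Context {R : realType}.
Implicit Types H C : R.

(* Covariance of the increments B_b - B_a and B_b' - B_a'. *)
Definition incr_cov H (a b a' b' : R) : R :=
  2^-1 * (`|b - a'| `^ (2 * H) + `|b' - a| `^ (2 * H)
          - `|b - b'| `^ (2 * H) - `|a - a'| `^ (2 * H)).

(* The ball of radius C of the Cameron-Martin space, described without
   its inner product: |<h, v>| <= C |v| for each v = sum_i c_i (B_(t_i) - B_(s_i)). Each condition involves finitely many values of h only. *)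
Definition cm_ball H C : set (I01 R -> R) := [set h | h (I01_0 R) = 0 /\
  forall n (c : 'I_n -> R) (s t : 'I_n -> I01 R),
    (\sum_(i < n) c i * (h (t i) - h (s i))) ^+ 2 <=
    C ^+ 2 * \sum_(i < n) \sum_(j < n) c i * c j *
      incr_cov H (val (s i)) (val (t i)) (val (s j)) (val (t j))].

Lemma incr_covC H a b a' b' : incr_cov H a b a' b' = incr_cov H a' b' a b.
Proof.
rewrite /incr_cov (distrC b b') (distrC a a'); congr (_ * _); lra.
Qed.

Lemma fbm_covC H (s t : I01 R) : fbm_cov H s t = fbm_cov H t s.
Proof. by rewrite /fbm_cov distrC (addrC (val s `^ _)). Qed.

Lemma incr_cov_fbm_cov H (s t s' t' : I01 R) :
  incr_cov H (val s) (val t) (val s') (val t') =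
  fbm_cov H t t' - fbm_cov H t s' - fbm_cov H s t' + fbm_cov H s s'.
Proof.
rewrite /incr_cov /fbm_cov (distrC (val t)) (distrC (val t) (val t')).
rewrite (distrC (val s)); lra.
Qed.

(** Cauchy-Schwarz for x and y = sum_i c_i (K_(t_i) - K_(s_i)): the reproducing property turns <x,
    y> into the left side of the ball condition and |y|^2 into its Gram sum. *)
Lemma cm_ball_rkhs H C (E : rkhs (@fbm_cov R H)) (x : E) :
  0 < H -> `|x| <= C -> cm_ball H C (rkhs_eval E x).
Proof.
move=> H0 xC.
have /choice[K Kp] := @rkhs_reproducing _ _ _ E.
have evK s t : rkhs_eval E (K t) s = fbm_cov H s t by have [->] := Kp t.
have dotK y t : rkhs_dot E y (K t) = rkhs_eval E y t by have [_ ->] := Kp t.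
have dotBr (y u v : E) : rkhs_dot E y (u - v) = rkhs_dot E y u - rkhs_dot E y v.
  exact: linearBr.
have dotBl (y u v : E) : rkhs_dot E (u - v) y = rkhs_dot E u y - rkhs_dot E v y.
  exact: linearBl.
(* Cauchy-Schwarz follows from the triangle inequality by expanding |u + v|^2. *)
have CS (y z : E) : (rkhs_dot E y z) ^+ 2 <= `|y| ^+ 2 * `|z| ^+ 2.
  have P (u v : E) : rkhs_dot E u v <= `|u| * `|v|.
    have : `|u + v| ^+ 2 <= (`|u| + `|v|) ^+ 2.
      by rewrite lerXn2r ?nnegrE ?addr_ge0// ler_normD.
    rewrite rkhs_normE hnormD/= -!rkhs_normE sqrrD expr0 mul1r.
    by lra.
  have N : - rkhs_dot E y z <= `|y| * `|z|.
    by rewrite -linearNl (le_trans (P _ _))// normrN.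
  have := P y z => {}P.
  rewrite -exprMn -(real_normK (num_real (rkhs_dot E y z))).
  by rewrite lerXn2r ?nnegrE ?mulr_ge0// ler_norml lerNl N.
split.
  (* The squared norm of K_0 is the variance at time 0, which vanishes; hence so does x(0) = <x,
     K_0>. *)
  have K0 : K (I01_0 R) = 0.
    apply/eqP; rewrite -normr_eq0 -sqrf_eq0 rkhs_normE dotK evK /fbm_cov/=.
    have H2 : 2 * H != 0 by rewrite mulf_neq0// gt_eqF.
    by rewrite subrr normr0 powR0// addr0 subrr mulr0.
  by rewrite -dotK K0 linear0r.
move=> n c s t.
pose y := \sum_(i < n) c i *: (K (t i) - K (s i)).
have -> : \sum_(i < n) c i * (rkhs_eval E x (t i) - rkhs_eval E x (s i)) =
    rkhs_dot E x y.
  rewrite linear_sumr; apply: eq_bigr => i _.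
  by rewrite linearZr_LR/= dotBr !dotK.
apply: (@le_trans _ _ (C ^+ 2 * `|y| ^+ 2)).
  apply: le_trans (CS _ _) _; rewrite ler_wpM2r ?sqr_ge0//.
  by rewrite lerXn2r ?nnegrE// (le_trans _ xC).
rewrite ler_wpM2l ?sqr_ge0// rkhs_normE.
rewrite {1}/y linear_sumlz; apply: ler_sum => i _.
rewrite linearZl_LR /= linear_sumr mulr_sumr; apply: ler_sum => j _.
rewrite linearZr_LR/= dotBr !dotBl !dotK !evK incr_cov_fbm_cov.
rewrite mulrA le_eqVlt; apply/orP; left; apply/eqP; congr (_ * _).
rewrite (fbm_covC _ (t j)) (fbm_covC _ (t j) (s i)).
rewrite (fbm_covC _ (s j)) (fbm_covC _ (s j) (s i)).
by lra.
Qed.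


Lemma powR_div (x y r : R) : 0 <= x -> 0 <= y -> (x / y) `^ r = x `^ r / y `^ r.
Proof.
move=> x0 y0; rewrite powRM ?invr_ge0// -powR_inv1// -powRrM mulN1r.
by rewrite powRN.
Qed.

(** Stationarity leaves only the distance |i - j|, and self-similarity extracts the factor
    N^(-2H). *)
Lemma incr_cov_grid H N k i j :
  `|incr_cov H (i%:R / N%:R) ((i + k)%:R / N%:R) (j%:R / N%:R) ((j + k)%:R / N%:R)| =
  `|second_diff (2 * H) k (i - j + (j - i))%N| / N%:R `^ (2 * H).
Proof.
have P m l : `|incr_cov H ((m + l)%:R / N%:R) ((m + l + k)%:R / N%:R) (m%:R / N%:R)
     ((m + k)%:R / N%:R)| = `|second_diff (2 * H) k l| / N%:R `^ (2 * H).
  have D (x y : R) : `|x / N%:R - y / N%:R| `^ (2 * H) =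
      `|x - y| `^ (2 * H) / N%:R `^ (2 * H).
    by rewrite -mulrBl normrM (ger0_norm (_ : 0 <= N%:R^-1)) ?powR_div.
  have e1 : (m + l + k)%:R - m%:R = (l + k)%:R :> R by rewrite !natrD; ring.
  have e2 : (m + k)%:R - (m + l)%:R = - (l%:R - k%:R) :> R by rewrite !natrD; ring.
  have e3 : (m + l + k)%:R - (m + k)%:R = l%:R :> R by rewrite !natrD; ring.
  have e4 : (m + l)%:R - m%:R = l%:R :> R by rewrite !natrD; ring.
  rewrite /incr_cov !D e1 e2 e3 e4 normrN !normr_nat.
  rewrite -[X in _ = _ / X]ger0_norm ?powR_ge0// -normf_div; congr (`|_|).
  by rewrite /second_diff; ring.
case: (leqP j i) => ij.
  have -> : (i - j + (j - i) = i - j)%N by lia.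
  by have := P j (i - j)%N; rewrite subnKC.
have -> : (i - j + (j - i) = j - i)%N by lia.
by have := P i (j - i)%N; rewrite subnKC ?(ltnW ij)// incr_covC.
Qed.

(* The point i / N, or 0 when i > N. *)
Definition grid N (i : nat) : I01 R := insubd (I01_0 R) (i%:R / N%:R).

Lemma gridE N i : (i <= N)%N -> val (grid N i) = i%:R / N%:R.
Proof.
move=> iN; rewrite /grid insubdK// inE /I01/= in_itv/= divr_ge0//=.
case: N iN => [|N] iN; first by rewrite invr0 mulr0.
by rewrite ler_pdivrMr// mul1r ler_nat.
Qed.

(** Schur test on the Gram matrix of the increments of lag k. The constant 4 is a factor 2 from
    [sum_dist_le] times a factor 2 from [sum_second_diff_le]. *)
Lemma sum_grid_incr_le H C N k h : 0 < H < 1 / 2 -> cm_ball H C h -> (k <= N)%N ->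
  \sum_(i < N.+1 - k) (h (grid N (i + k)) - h (grid N i)) ^+ 2 <=
  C ^+ 2 * (4 * (k%:R * k%:R `^ (2 * H)) / N%:R `^ (2 * H)).
Proof.
move=> /andP[H0 H1] [_ hC] kN.
have H2 : 0 < 2 * H < 1 by lra.
set n := (N.+1 - k)%N.
pose s (i : 'I_n) := grid N i; pose t (i : 'I_n) := grid N (i + k).
have sE i : val (s i) = i%:R / N%:R by rewrite gridE//; have := ltn_ord i; lia.
have tE i : val (t i) = (i + k)%:R / N%:R by rewrite gridE//; have := ltn_ord i; lia.
(* Taking the increments of [h] themselves as coefficients makes the left side the square of the sum
   to be bounded. *)
have := hC n (fun i => h (t i) - h (s i)) s t.
under eq_bigr do rewrite -expr2.
apply: (schur_test (G := fun i j =>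
  incr_cov H (val (s i)) (val (t i)) (val (s j)) (val (t j)))).
- by rewrite divr_ge0 ?mulr_ge0 ?powR_ge0.
- by move=> i j; rewrite incr_covC.
- move=> i; under eq_bigr do rewrite !sE !tE incr_cov_grid.
  rewrite -mulr_suml ler_wpM2r ?invr_ge0 ?powR_ge0//.
  apply: le_trans
    (sum_dist_le (F := fun l => `|second_diff (2 * H) k l|) (ltn_ord i) _) _ => //.
  have := sum_second_diff_le k n H2; lra.
Qed.

(** Integrand of the squared W^{d,2} seminorm; on the diagonal it is 0, as its numerator is. *)
Definition slob (d : R) (h : I01 R -> R) (s t : I01 R) : R :=
  (h t - h s) ^+ 2 / `|val t - val s| `^ (1 + 2 * d).

(** With b = 2d - 2H, the diagonal of lag k contributes at most A k^(-b), where A = 4 C^2 N^(1+b).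
    Summing k^(-b) costs N^(1-b)/(1-b), which leaves N^2, the inverse of the area of a grid cell. *)
Lemma sum_grid_slob_le H C N d h : 0 < H < 1 / 2 -> 0 < 2 * d - 2 * H < 1 ->
  cm_ball H C h -> (0 < N)%N ->
  \sum_(i < N.+1) \sum_(j < N.+1) slob d h (grid N i) (grid N j) <=
  C ^+ 2 * (8 / (1 - (2 * d - 2 * H))) * N%:R ^+ 2.
Proof.
move=> H01 d01 hC N0.
set b := 2 * d - 2 * H.
rewrite (sum_sym_diag _ (F := fun i j => slob d h (grid N i) (grid N j))); last 2 first.
- by move=> i j; rewrite /slob distrC -[in RHS](sqrrN (_ - _)) opprB.
- by move=> i; rewrite /slob subrr expr0n mul0r.
have NR : 0 < N%:R :> R by rewrite ltr0n.
pose A : R := C ^+ 2 * 4 * N%:R `^ (1 + b).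
have diag (k : nat) : (0 < k <= N)%N ->
    \sum_(i < N.+1 - k) slob d h (grid N i) (grid N (i + k)) <= A * k%:R `^ (- b).
  move=> /andP[k0 kN].
  have kR : 0 < k%:R :> R by rewrite ltr0n.
  have E (i : 'I_(N.+1 - k)) : slob d h (grid N i) (grid N (i + k)) =
      (h (grid N (i + k)) - h (grid N i)) ^+ 2 * (k%:R / N%:R) `^ (- (1 + 2 * d)).
    rewrite /slob powRN !gridE; [|have := ltn_ord i; lia..].
    by rewrite -mulrBl natrD addrAC subrr add0r ger0_norm// divr_ge0.
  under eq_bigr do rewrite E.
  rewrite -mulr_suml.
  apply: le_trans (ler_wpM2r (powR_ge0 _ _) (sum_grid_incr_le H01 hC kN)) _.
  rewrite powR_div// !(powRN _ (1 + 2 * d)) invrK le_eqVlt; apply/orP; left; apply/eqP.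
  have kE : k%:R `^ (- b) = k%:R * k%:R `^ (2 * H) / k%:R `^ (1 + 2 * d) :> R.
    rewrite -{2}(powRr1 (ltW kR)) -powRD ?pnatr_eq0 -?lt0n ?k0 ?implybT// -powRB.
      by congr (_ `^ _); rewrite /b; ring.
    by rewrite pnatr_eq0 -lt0n k0 implybT.
  have NE : N%:R `^ (1 + b) = N%:R `^ (1 + 2 * d) / N%:R `^ (2 * H) :> R.
    rewrite -powRB; first by congr (_ `^ _); rewrite /b; ring.
    by rewrite pnatr_eq0 -lt0n N0 implybT.
  by rewrite /A kE NE; ring.
(* Lag 0 contributes nothing; the remaining lags are shifted to k + 1. *)
rewrite big_ord_recl/= big1 ?add0r; last first.
  by move=> i _; rewrite addn0 /slob subrr expr0n mul0r.
apply: (@le_trans _ _ (2 * \sum_(k < N) A * k.+1%:R `^ (- b))).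
  rewrite ler_wpM2l//; apply: ler_sum => k _; apply: diag.
  by rewrite /= ltn_ord.
rewrite -mulr_sumr.
have A0 : 0 <= A by rewrite mulr_ge0 ?powR_ge0// mulr_ge0 ?sqr_ge0.
apply: (@le_trans _ _ (2 * (A * (N%:R `^ (1 - b) / (1 - b))))).
  by rewrite ler_wpM2l// ler_wpM2l// sum_powRN_le.
have NE : N%:R `^ (1 + b) * N%:R `^ (1 - b) = N%:R ^+ 2 :> R.
  rewrite -powRD ?pnatr_eq0 -?lt0n ?N0 ?implybT// -powR_mulrn ?ltW//.
  by congr (_ `^ _); ring.
by rewrite -NE /A le_eqVlt; apply/orP; left; apply/eqP; ring.
Qed.

End CameronMartinBall.

(** * Uniform Hölder regularity on the ball *)

Section Regularity.
Context {R : realType}.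
Variables (H C : R) (h : I01 R -> R).
Hypotheses (H01 : 0 < H < 1 / 2) (C0 : 0 <= C) (hC : cm_ball H C h).

(** The ball condition for a single increment, whose variance is |t - s|^(2H). *)
Lemma cm_ball_holder s t : `|h t - h s| <= C * `|val t - val s| `^ H.
Proof.
have [H0 H1] := andP H01.
have := hC.2 1%N (fun=> 1) (fun=> s) (fun=> t).
rewrite !big_ord_recl !big_ord0 !mul1r !addr0 /incr_cov !subrr normr0.
rewrite powR0; last by rewrite mulf_neq0// gt_eqF.
rewrite !subr0 -mulr2n -[X in 2^-1 * X]mulr_natl mulKf// => hh.
rewrite -(@ler_pXn2r _ 2%N)// ?nnegrE ?mulr_ge0 ?powR_ge0//.
rewrite real_normK ?num_real// (le_trans hh)// exprMn ler_wpM2l ?sqr_ge0//.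
by rewrite -(powR_mulrn _ (powR_ge0 _ _)) -powRrM mulrC.
Qed.

Lemma cm_ball_bound s t : `|h t - h s| <= C.
Proof.
have [H0 H1] := andP H01.
apply: le_trans (cm_ball_holder s t) _.
have : `|val t - val s| <= 1.
  have := set_mem (valP t); have := set_mem (valP s).
  rewrite /I01/= !in_itv/= => /andP[? ?] /andP[? ?]; rewrite ler_norml; lra.
move=> ts; rewrite ler_piMr//.
apply: (@le_trans _ _ (1 `^ H)); last by rewrite powR1.
by rewrite ge0_ler_powR ?nnegrE ?(ltW H0).
Qed.

Lemma cm_ball_continuous : continuous h.
Proof.
have [H0 H1] := andP H01.
move=> s; apply/(@cvgrPdist_lt _ _ _ (nbhs s) (nbhs_filter s)) => e e0.
(* Dividing by C + 1 instead of C covers C = 0. *)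
have C1 : 0 < C + 1 by rewrite ltr_wpDl.
have r0 : 0 < (e / (C + 1)) `^ H^-1 by rewrite powR_gt0// divr_gt0.
apply/nbhs_ballP; exists ((e / (C + 1)) `^ H^-1) => // t st.
have {}st : `|val s - val t| < (e / (C + 1)) `^ H^-1 by exact: st.
apply: le_lt_trans (cm_ball_holder _ _) _.
have E : ((e / (C + 1)) `^ H^-1) `^ H = e / (C + 1).
  by rewrite -powRrM mulVf ?gt_eqF// powRr1// divr_ge0// ltW.
have : `|val s - val t| `^ H < e / (C + 1).
  by rewrite -E gt0_ltr_powR ?nnegrE ?powR_ge0.
rewrite ltr_pdivlMr// mulrC => /(le_lt_trans _); apply.
by rewrite ler_wpM2r ?powR_ge0// lerDl.
Qed.

Lemma cm_ball_measurable : measurable_fun (I01 R) (ext0 h).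
Proof.
apply: subspace_continuous_measurable_fun; first exact: measurable_itv.
apply/subspace_sigL_continuousP.
rewrite (_ : sigL _ _ = h); first exact: cm_ball_continuous.
apply/funext => t; exact: ext0E.
Qed.

End Regularity.

(** * Step functions on grid cells approximating the Slobodeckij integrand *)

Section StepApproximation.
Context {R : realType}.
Local Notation I := (I01 R).
Local Notation mu := (@lebesgue_measure R).

Lemma le_limn_einf (u v : (\bar R)^nat) :
  (forall n, (u n <= v n)%E) -> (limn_einf u <= limn_einf v)%E.
Proof.
move=> uv; rewrite !limn_einf_lim; apply: lee_lim; [exact: is_cvg_einfs..|].
apply: nearW => n; apply: le_ereal_inf_tmp => _ [m /= nm <-].
by apply: le_trans (uv m); apply: ereal_inf_lbound; exists m.
Qed.

Let mI : measurable (I : set R).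
Proof. exact: measurable_itv. Qed.

Let mII : measurable (I `*` I : set (R * R)).
Proof. exact: measurableX. Qed.

(** Written exactly as the integrand of [W_norm] at p = 2, so that [W_norm_slob] holds by
    conversion. *)
Definition slob_ext (d : R) (h : I -> R) (z : R * R) : R :=
  `|ext0 h z.2 - ext0 h z.1| `^ 2 / `|z.2 - z.1| `^ (1 + d * 2).

Lemma slob_extE d h (s t : I) : slob_ext d h (val s, val t) = slob d h s t.
Proof.
rewrite /slob_ext /slob/= !ext0E (mulrC d) powR_mulrn// real_normK//.
exact: num_real.
Qed.

Lemma slob_ge0 d h (s t : I) : 0 <= slob d h s t.
Proof. by rewrite /slob divr_ge0 ?sqr_ge0 ?powR_ge0. Qed.

Lemma slob_ext_ge0 d h z : 0 <= slob_ext d h z.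
Proof. by rewrite /slob_ext divr_ge0 ?powR_ge0. Qed.

Lemma slob_ext_measurable d h : measurable_fun I (ext0 h) ->
  measurable_fun (I `*` I) (slob_ext d h).
Proof.
move=> mh; apply: measurable_funM.
  apply: (@measurableT_comp _ _ _ _ _ _ (@powR R ^~ 2)) => //.
  apply: measurableT_comp => //; apply: measurable_funB.
  - apply: (measurable_comp mI _ mh) => [_ [z [_ ?]] <-//|].
    exact: measurable_funTS.
  - apply: (measurable_comp mI _ mh) => [_ [z [? _]] <-//|].
    exact: measurable_funTS.
under eq_fun do rewrite -powRN.
apply: (@measurableT_comp _ _ _ _ _ _ (@powR R ^~ (- (1 + d * 2)))) => //.
apply: measurable_funTS.
apply: measurableT_comp => //.
exact: measurable_funB.
Qed.

Definition cell N i : set R := `[i%:R / N%:R, i.+1%:R / N%:R[.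

(** The index is the integer part of sN. It equals N only at s = 1, whence N + 1 cells, the last
    starting at 1. *)
Lemma cellP N (s : I) : (0 < N)%N ->
  let i := Num.truncn (val s * N%:R) in
  [/\ (i < N.+1)%N, cell N i (val s) & `|val s - val (grid N i)| <= N%:R^-1].
Proof.
move=> N0 i; have NR : 0 < N%:R :> R by rewrite ltr0n.
have := set_mem (valP s); rewrite /I01/= in_itv/= => /andP[s0 s1].
have sN : 0 <= val s * N%:R by rewrite mulr_ge0.
have /andP[i1 i2] := truncn_itv sN; rewrite -/i in i1 i2.
have iN : (i <= N)%N.
  by rewrite -(ler_nat R) (le_trans i1)// ler_piMl// ltW.
have c1 : i%:R / N%:R <= val s by rewrite ler_pdivrMr.
have c2 : val s < i.+1%:R / N%:R by rewrite ltr_pdivlMr.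
split => //; first by rewrite /cell/= in_itv/= c1 c2.
rewrite gridE// ger0_norm ?subr_ge0// lerBlDl (le_trans (ltW c2))//.
by rewrite -natr1 mulrDl mul1r.
Qed.

Definition slob_step d h N (z : R * R) : R :=
  \sum_(i < N.+1) \sum_(j < N.+1)
    slob d h (grid N i) (grid N j) * \1_(cell N i `*` cell N j) z.

(** Keep the term of the cell product containing (s, t); the others are nonnegative, so disjointness
    of the cells need not be shown. *)
Lemma slob_step_ge d h N (s t : I) : (0 < N)%N ->
  slob d h (grid N (Num.truncn (val s * N%:R))) (grid N (Num.truncn (val t * N%:R)))
    <= slob_step d h N (val s, val t).
Proof.
move=> N0; rewrite /slob_step.
have [iN ci _] := cellP s N0; have [jN cj _] := cellP t N0.
rewrite (bigD1 (Ordinal iN))//= (bigD1 (Ordinal jN))//=.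
rewrite indicE mem_set//= mulr1 -addrA lerDl addr_ge0// sumr_ge0// => i _.
  by rewrite mulr_ge0// slob_ge0.
by apply: sumr_ge0 => j _; rewrite mulr_ge0// slob_ge0.
Qed.

(** Each product of cells has area 1/N^2, and intersecting it with the unit square can only decrease
    this. *)
Lemma integral_slob_step_le d h N : (0 < N)%N ->
  (\int[mu \x mu]_(z in I `*` I) (slob_step d h N z)%:E <=
   (\sum_(i < N.+1) \sum_(j < N.+1) slob d h (grid N i) (grid N j) / N%:R ^+ 2)%:E)%E.
Proof.
move=> N0; have NR : 0 < N%:R :> R by rewrite ltr0n.
have mcell i j : measurable (cell N i `*` cell N j).
  by apply: measurableX; exact: measurable_itv.
have mterm i j : measurable_fun (I `*` I) (fun z =>
    (slob d h (grid N i) (grid N j) * \1_(cell N i `*` cell N j) z)%:E).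
  by apply/measurable_EFinP; apply: measurable_funM => //; exact: measurable_indic.
under eq_integral do rewrite /slob_step -sumEFin.
rewrite ge0_integral_sum//; last 2 first.
- move=> i; apply/measurable_EFinP/measurable_sum => j.
  by apply/measurable_EFinP; exact: mterm.
- by move=> i z _; rewrite lee_fin sumr_ge0// => j _; rewrite mulr_ge0// slob_ge0.
rewrite -sumEFin; apply: lee_sum => i _.
under eq_integral do rewrite -sumEFin.
rewrite ge0_integral_sum//; last 2 first.
- by move=> j; exact: mterm.
- by move=> j z _; rewrite lee_fin mulr_ge0// slob_ge0.
rewrite -sumEFin; apply: lee_sum => j _.
under eq_integral do rewrite EFinM.
rewrite ge0_integralZl//; last 2 first.
- by apply/measurable_EFinP; apply: measurable_indic; exact: mcell.
- by rewrite lee_fin slob_ge0.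
rewrite integral_indic; [|exact: mII|exact: mcell].
rewrite [leRHS]EFinM; apply: lee_wpmul2l; first by rewrite lee_fin slob_ge0.
apply: (@le_trans _ _ ((mu \x mu)%E (cell N i `*` cell N j))).
  apply: le_measure; rewrite ?inE; [|exact: mcell|exact: subIsetl].
  by apply: measurableI; [exact: mcell|exact: mII].
rewrite [leLHS]product_measure1E//=; [|exact: measurable_itv..].
have mc k : mu (cell N k) = (N%:R^-1)%:E.
  rewrite /cell lebesgue_measure_itv/= lte_fin ltr_pM2r ?invr_gt0// ltr_nat ltnSn.
  by rewrite -EFinD -mulrBl -natr1 addrAC subrr add0r mul1r.
by rewrite !mc -EFinM lee_fin -exprVn expr2.
Qed.

End StepApproximation.

(** * Passage to the limit in the mesh *)

Section SlobodeckijBound.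
Context {R : realType}.
Local Notation I := (I01 R).
Local Notation mu := (@lebesgue_measure R).

Lemma powR_continuous (r x : R) : 0 < x -> {for x, continuous (@powR R ^~ r)}.
Proof.
move=> x0; apply/differentiable_continuous/derivable1_diffP.
by apply: derivable_powR; rewrite in_itv/= x0.
Qed.

Lemma cvg_grid (s : I) : grid n.+1 (Num.truncn (val s * n.+1%:R)) @[n --> \oo] --> s.
Proof.
apply/cvg_ballP => e e0; near=> n.
have [_ _ h] := cellP s (ltn0Sn n).
apply: (le_lt_trans h); near: n.
exact: (near_infty_natSinv_lt (PosNum e0)).
Unshelve. all: by end_near. Qed.

Lemma val_I01_continuous : continuous (val : I -> R).
Proof. exact: initial_continuous. Qed.

(** Off the diagonal the denominator has a positive limit, so the quotient is continuous there. *)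
Lemma cvg_slob_grid d h (s t : I) : continuous h -> s != t ->
  slob d h (grid n.+1 (Num.truncn (val s * n.+1%:R)))
           (grid n.+1 (Num.truncn (val t * n.+1%:R))) @[n --> \oo] --> slob d h s t.
Proof.
move=> ch st.
have cv (u : I -> R) (x : I) : continuous u ->
    u (grid n.+1 (Num.truncn (val x * n.+1%:R))) @[n --> \oo] --> u x.
  by move=> cu; apply: (@cvg_comp _ _ _ _ u _ (nbhs x)); [exact: cvg_grid|exact: cu].
have ts0 : 0 < `|val t - val s|.
  by rewrite normr_gt0 subr_eq0; apply: contra st => /eqP/val_inj ->.
rewrite /slob; apply: cvgM.
  apply: (@cvg_comp _ _ _ _ (fun x => x ^+ 2) _ (nbhs (h t - h s))).
    by apply: cvgB; exact: cv.
  exact: exprn_continuous.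
apply: cvgV; first by rewrite gt_eqF// powR_gt0.
apply: (@cvg_comp _ _ _ _ (@powR R ^~ (1 + 2 * d)) _ (nbhs `|val t - val s|)).
  by apply: cvg_norm; apply: cvgB; apply: cv; exact: val_I01_continuous.
exact: powR_continuous.
Qed.

(** Fatou's lemma: the integrand is at most the lower limit of the step functions, whose integrals
    are all bounded by [M]. *)
Lemma integral_slob_le H C d h : 0 < H < 1 / 2 -> 0 <= C ->
  0 < 2 * d - 2 * H < 1 -> cm_ball H C h ->
  (\int[mu \x mu]_(z in I `*` I) (slob_ext d h z)%:E <=
   (C ^+ 2 * (8 / (1 - (2 * d - 2 * H))))%:E)%E.
Proof.
move=> H01 C0 d01 hC; set M := C ^+ 2 * _.
have mI : measurable (I : set R) by exact: measurable_itv.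
have mII : measurable (I `*` I : set (R * R)) by exact: measurableX.
have ch := cm_ball_continuous H01 C0 hC.
have mstep n : measurable_fun (I `*` I) (fun z => (slob_step d h n.+1 z)%:E).
  apply/measurable_EFinP/measurable_sum => i; apply: measurable_sum => j.
  apply: measurable_funM => //; apply: measurable_indic.
  by apply: measurableX; exact: measurable_itv.
have step0 n z : (0 <= (slob_step d h n.+1 z)%:E)%E.
  rewrite lee_fin sumr_ge0// => i _; apply: sumr_ge0 => j _.
  by rewrite mulr_ge0// slob_ge0.
apply: (@le_trans _ _ (\int[mu \x mu]_(z in I `*` I)
    limn_einf (fun n => (slob_step d h n.+1 z)%:E))%E).
  apply: ge0_le_integral => //.
  - by move=> z _; rewrite lee_fin slob_ext_ge0.
  - by apply/measurable_EFinP; apply: slob_ext_measurable; apply: cm_ball_measurable hC.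
  (* The lower limit is measurable as minus the upper limit of the opposites. *)
  - apply: measurableT_comp => //; apply: measurable_fun_limn_esup => n.
    by apply: (@measurableT_comp _ _ _ _ _ _ oppe) => //; exact: mstep.
  move=> [x y] [/= Ix Iy].
  pose s : I := SigSub (mem_set Ix); pose t : I := SigSub (mem_set Iy).
  rewrite -[x]/(val s) -[y]/(val t) slob_extE.
  (* On the diagonal the integrand is 0 and nonnegativity of the step functions suffices. *)
  have [<-|st] := eqVneq s t.
    rewrite /slob subrr expr0n mul0r.
    have <- : limn_einf (cst (0 : R)%:E : (\bar R)^nat) = (0 : R)%:E.
      by apply: (cvg_limn_einf_sup _).1; exact: cvg_cst.
    by apply: le_limn_einf => n; exact: step0.
  pose u n := (slob d h (grid n.+1 (Num.truncn (val s * n.+1%:R)))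
                        (grid n.+1 (Num.truncn (val t * n.+1%:R))))%:E.
  have <- : limn_einf u = (slob d h s t)%:E.
    apply: (cvg_limn_einf_sup _).1; apply: cvg_EFin; first exact: nearW.
    exact: cvg_slob_grid.
  by apply: le_limn_einf => n; rewrite lee_fin slob_step_ge.
apply: (le_trans (fatou _ _ _ _)) => //.
have <- : limn_einf (cst M%:E) = M%:E.
  by apply: (cvg_limn_einf_sup _).1; exact: cvg_cst.
apply: le_limn_einf => n /=; apply: le_trans (integral_slob_step_le d h (ltn0Sn n)) _.
rewrite lee_fin; under eq_bigr do rewrite -mulr_suml.
rewrite -mulr_suml ler_pdivrMr ?exprn_gt0//.
exact: sum_grid_slob_le.
Qed.

End SlobodeckijBound.

(** * Membership of the ball in the Slobodeckij space, and interpolation *)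

Section SlobodeckijNorm.
Context {R : realType}.
Local Notation I := (I01 R).
Local Notation mu := (@lebesgue_measure R).

Lemma W_norm_slob (d : R) (h : I -> R) : W_norm d 2 h =
  ((\int[mu \x mu]_(z in I `*` I) (slob_ext d h z)%:E) `^ 2^-1)%E.
Proof. by []. Qed.

Lemma lebesgue_measure_I01 : mu I = 1%E.
Proof. by rewrite /I01 lebesgue_measure_itv/= lte_fin ltr01 oppr0 adde0. Qed.

Lemma cm_ball_W0 (H C d : R) (h : I -> R) : 0 < H < 1 / 2 -> 0 <= C ->
  0 < 2 * d - 2 * H < 1 -> cm_ball H C h -> W0_set d 2 h.
Proof.
move=> H01 C0 d01 hC.
have mh := cm_ball_measurable H01 C0 hC.
split; [|exact: cm_ball_continuous hC|exact: hC.1].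
split => //; apply: lte_add_pinfty; apply: poweR_lty; last first.
  by apply: le_lt_trans (integral_slob_le H01 C0 d01 hC) _; exact: ltry.
have mI : measurable (I : set R) by exact: measurable_itv.
apply: (@le_lt_trans _ _ (\int[mu]_(t in I) (cst (C `^ 2)%:E t))%E).
  apply: ge0_le_integral => //.
  - apply/measurable_EFinP; apply: (@measurableT_comp _ _ _ _ _ _ (@powR R ^~ 2)) => //.
    exact: measurableT_comp.
  move=> t It; pose s : I := SigSub (mem_set It).
  rewrite -[t]/(val s) ext0E lee_fin ge0_ler_powR ?nnegrE//.
  by have := cm_ball_bound H01 C0 hC (I01_0 R) s; rewrite hC.1 subr0.
by rewrite integral_cst// [X in (_ * X)%E]lebesgue_measure_I01 mule1 ltry.
Qed.

(** For 0 < r <= e the first term dominates, since r^(-a) = r^(b-a) r^(-b); for r > e the second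
    does. At r = 0 the left side is 0 by the convention on inverses. *)
Lemma powRN_split (e a b r : R) : 0 < e -> 0 < a <= b -> 0 <= r ->
  (r `^ a)^-1 <= e `^ (b - a) * (r `^ b)^-1 + (e `^ a)^-1.
Proof.
move=> e0 /andP[a0 ab]; rewrite le_eqVlt => /predU1P[<-|r0].
  by rewrite powR0 ?gt_eqF// invr0 addr_ge0 ?mulr_ge0 ?invr_ge0 ?powR_ge0.
have [re|er] := leP r e; last first.
  apply: ler_wpDl; first by rewrite mulr_ge0 ?invr_ge0 ?powR_ge0.
  rewrite lef_pV2 ?posrE ?powR_gt0//.
  by rewrite ge0_ler_powR ?nnegrE ?(ltW a0) ?(ltW e0) ?(ltW r0) ?(ltW er).
apply: ler_wpDr; first by rewrite invr_ge0 powR_ge0.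
rewrite ler_pdivlMr ?powR_gt0// mulrC -powRB; last by rewrite (gt_eqF r0) implybT.
by rewrite ge0_ler_powR ?nnegrE ?subr_ge0 ?(ltW e0) ?(ltW r0) ?re.
Qed.

(* Interpolation: the part of the integral near the diagonal is controlled by a
   slightly stronger norm, the remaining part by the uniform norm. *)
Lemma integral_slob_interp d d' e m h : 0 < e -> 0 < d <= d' ->
  measurable_fun I (ext0 h) -> (forall s t, `|h t - h s| <= m) ->
  (\int[mu \x mu]_(z in I `*` I) (slob_ext d h z)%:E <=
   (e `^ (2 * (d' - d)))%:E * \int[mu \x mu]_(z in I `*` I) (slob_ext d' h z)%:E
   + (m ^+ 2 / e `^ (1 + 2 * d))%:E)%E.
Proof.
move=> e0 dd' mh hm.
have mI : measurable (I : set R) by exact: measurable_itv.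
have mII : measurable (I `*` I : set (R * R)) by exact: measurableX.
have m0 : 0 <= m by exact: le_trans (hm (I01_0 R) (I01_0 R)).
have mS c : measurable_fun (I `*` I) (fun z => (slob_ext c h z)%:E).
  by apply/measurable_EFinP; exact: slob_ext_measurable.
have k0 : 0 <= m ^+ 2 / e `^ (1 + 2 * d) by rewrite divr_ge0 ?sqr_ge0 ?powR_ge0.
rewrite -ge0_integralZl//; last 3 first.
- exact: mS.
- by move=> z _; rewrite lee_fin slob_ext_ge0.
- by rewrite lee_fin powR_ge0.
set k := m ^+ 2 / _ in k0 *.
have <- : (\int[mu \x mu]_(z in I `*` I) (cst k%:E z) = k%:E)%E.
  rewrite integral_cst// [X in (_ * X)%E](product_measure1E mu mu mI mI).
  by rewrite /= !lebesgue_measure_I01 !mule1.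
rewrite -ge0_integralD//; last 2 first.
- by move=> z _; rewrite -EFinM lee_fin mulr_ge0 ?powR_ge0 ?slob_ext_ge0.
- by apply: emeasurable_funM => //; exact: mS.
apply: ge0_le_integral => //.
- by move=> z _; rewrite lee_fin slob_ext_ge0.
- exact: mS.
- apply: emeasurable_funD => //; apply: emeasurable_funM => //; exact: mS.
move=> [x y] [/= Ix Iy].
pose s : I := SigSub (mem_set Ix); pose t : I := SigSub (mem_set Iy).
rewrite -[x]/(val s) -[y]/(val t) !slob_extE -EFinM -EFinD lee_fin /slob.
have a0 : 0 < 1 + 2 * d <= 1 + 2 * d' by lra.
have := powRN_split e0 a0 (normr_ge0 (val t - val s)).
rewrite (_ : 1 + 2 * d' - (1 + 2 * d) = 2 * (d' - d)); last by ring.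
move=> /(ler_wpM2l (sqr_ge0 (h t - h s))) /le_trans; apply.
rewrite mulrDr mulrCA lerD2l ler_wpM2r ?invr_ge0 ?powR_ge0//.
by rewrite -(real_normK (num_real (h t - h s))) lerXn2r ?nnegrE ?hm.
Qed.

End SlobodeckijNorm.

(** * From smallness on a finite grid to smallness in norm *)

Section Smallness.
Context {R : realType}.
Local Notation I := (I01 R).
Local Notation mu := (@lebesgue_measure R).
Variables (H : R).
Hypothesis H01 : 0 < H < 1 / 2.

(** Follows from (b - a)^2 <= 2 a^2 + 2 b^2. *)
Lemma cm_ballB (C : R) (f g : I -> R) : cm_ball H C f -> cm_ball H C g ->
  cm_ball H (2 * C) (f - g).
Proof.
move=> [f0 hf] [g0 hg]; split; first by rewrite !fctE f0 g0 subrr.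
move=> n c s t; rewrite exprMn.
have {hf} := hf n c s t; have {hg} := hg n c s t.
set Q := \sum_(i < n) \sum_(j < n) _; set a := \sum_(i < n) _; set b := \sum_(i < n) _.
rewrite (_ : \sum_(i < n) _ = b - a); last first.
  by rewrite /a /b -sumrB; apply: eq_bigr => i _; rewrite !fctE; ring.
have := sqr_ge0 (a + b); rewrite -mulrA sqrrB sqrrD.
move: (C ^+ 2 * Q) => q; lra.
Qed.

(** Interpolation between the uniform norm and a stronger seminorm bounded on the ball: each of the
    two terms is made at most eps^2/4. *)
Lemma cm_ball_W_norm_lt (C d eps : R) : 0 <= C -> 0 < d < H + 1 / 2 -> H < d ->
  0 < eps ->
  exists2 r : R, 0 < r & forall h : I -> R, cm_ball H C h ->
    (forall t, `|h t| <= r) -> (W_norm d 2 h < eps%:E)%E.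
Proof.
move=> C0 /andP[d0 dH] Hd eps0; have /andP[H0 H1] := H01.
(* The midpoint leaves room both above [d] and below H + 1/2. *)
pose d' := (d + (H + 1 / 2)) / 2.
have dd' : d < d' by rewrite /d'; lra.
have d'1 : 0 < 2 * d' - 2 * H < 1 by rewrite /d'; lra.
pose M := C ^+ 2 * (8 / (1 - (2 * d' - 2 * H))).
have M0 : 0 <= M by rewrite mulr_ge0 ?sqr_ge0// divr_ge0//; lra.
have p0 : 0 < 2 * (d' - d) by lra.
(* Solves e^(2(d'-d)) = eps^2 / (4(M+1)); the summand 1 covers M = 0. *)
pose e := (eps ^+ 2 / (4 * (M + 1))) `^ (2 * (d' - d))^-1.
have M1 : 0 < 4 * (M + 1) by lra.
have q0 : 0 < eps ^+ 2 / (4 * (M + 1)) by rewrite divr_gt0// exprn_gt0.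
have e0 : 0 < e by exact: powR_gt0.
have eE : e `^ (2 * (d' - d)) = eps ^+ 2 / (4 * (M + 1)).
  by rewrite /e -powRrM mulVf ?gt_eqF// powRr1// ltW.
(* Solves (2r)^2 / e^(1+2d) = eps^2/4, where 2r bounds the increments of [h]. *)
pose r := Num.sqrt (eps ^+ 2 * e `^ (1 + 2 * d)) / 4.
have r0 : 0 < r by rewrite divr_gt0// sqrtr_gt0 mulr_gt0 ?exprn_gt0// powR_gt0.
exists r => // h hC hr.
have hst s t : `|h t - h s| <= 2 * r.
  by rewrite (le_trans (ler_normB _ _))// mulr_natl mulr2n lerD.
have dd : 0 < d <= d' by rewrite d0 ltW.
have := integral_slob_interp e0 dd (cm_ball_measurable H01 C0 hC) hst.
have A0 : (0 <= \int[mu \x mu]_(z in I `*` I) (slob_ext d h z)%:E)%E.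
  by apply: integral_ge0 => z _; rewrite lee_fin slob_ext_ge0.
have := integral_slob_le H01 C0 d'1 hC; rewrite -/M eE => le1 le2.
have {}le2 : (\int[mu \x mu]_(z in I `*` I) (slob_ext d h z)%:E <= (eps ^+ 2 / 2)%:E)%E.
  apply: (le_trans le2).
  apply: (@le_trans _ _ ((eps ^+ 2 / (4 * (M + 1)))%:E * M%:E
      + ((2 * r) ^+ 2 / e `^ (1 + 2 * d))%:E)%E).
    by rewrite leeD2r// lee_wpmul2l// lee_fin ltW.
  rewrite -EFinM -EFinD lee_fin.
  have -> : (2 * r) ^+ 2 / e `^ (1 + 2 * d) = eps ^+ 2 / 4.
    rewrite /r !exprMn sqr_sqrtr; last exact: mulr_ge0 (sqr_ge0 _) (powR_ge0 _ _).
    have : e `^ (1 + 2 * d) != 0 by rewrite gt_eqF// powR_gt0.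
    move: (e `^ _) => u u0; field.
    by rewrite u0.
  have : eps ^+ 2 / (4 * (M + 1)) * M <= eps ^+ 2 / 4.
    move: (eps ^+ 2) (sqr_ge0 eps) => w w0.
    rewrite mulrAC ler_pdivrMr// -[leRHS]mulrA ler_wpM2l//; lra.
  lra.
rewrite W_norm_slob.
apply: (@le_lt_trans _ _ ((eps ^+ 2 / 2) `^ 2^-1)%:E).
  rewrite -poweR_EFin gt0_ler_poweR ?invr_ge0//.
    by rewrite in_itv/= A0 leey.
  by rewrite in_itv/= lee_fin divr_ge0 ?sqr_ge0// leey.
rewrite lte_fin powR12_sqrt ?divr_ge0 ?sqr_ge0//.
rewrite -[ltRHS]ger0_norm ?(ltW eps0)// -sqrtr_sqr ltr_sqrt ?exprn_gt0//.
have : 0 < eps ^+ 2 by rewrite exprn_gt0.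
lra.
Qed.

(** By the common Hölder bound, a fine enough mesh 1/(N+1) keeps h(t) within r/2 of its value at a
    grid point, for all [h] in the ball at once. *)
Lemma cm_ball_grid_le (C r : R) : 0 <= C -> 0 < r -> exists N,
  forall h : I -> R, cm_ball H C h ->
    (forall i : 'I_N.+2, `|h (grid N.+1 i)| <= r / 2) -> forall t, `|h t| <= r.
Proof.
move=> C0 r0; have /andP[H0 H1] := H01.
have C1 : 0 < 2 * (C + 1) by lra.
have q0 : 0 < r / (2 * (C + 1)) by rewrite divr_gt0.
have e0 : 0 < (r / (2 * (C + 1))) `^ H^-1 by exact: powR_gt0.
have [N _ /(_ N (leqnn N)) /= hN] := near_infty_natSinv_lt (PosNum e0).
exists N => h hC hg t.
have [iN _ tN] := cellP t (ltn0Sn N).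
set p := grid _ _ in tN.
have hp : `|h p| <= r / 2 by exact: (hg (Ordinal iN)).
have ht : `|h t - h p| <= r / 2.
  apply: (le_trans (cm_ball_holder H01 C0 hC _ _)).
  have : `|val t - val p| `^ H <= r / (2 * (C + 1)).
    have -> : r / (2 * (C + 1)) = ((r / (2 * (C + 1))) `^ H^-1) `^ H.
      by rewrite -powRrM mulVf ?gt_eqF// powRr1// ltW.
    rewrite ge0_ler_powR ?nnegrE ?(ltW H0) ?powR_ge0//.
    exact: le_trans tN (ltW hN).
  move=> /(ler_wpM2l C0)/le_trans; apply.
  rewrite mulrA ler_pdivrMr// mulrC.
  have := mulr_ge0 C0 (ltW r0); lra.
rewrite -(subrK (h p) (h t)) (le_trans (ler_normD _ _))//.
by rewrite (le_trans (lerD ht hp))//; lra.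
Qed.

End Smallness.

(** Provides the pointwise continuity in h of the left side of the ball condition, from which the
    ball is shown to be closed. *)
Lemma cvg_sum_incr_sqr (R : realType) (T : Type) (F : set_system T)
    (FF : Filter F) n (c : 'I_n -> R) (u v : 'I_n -> T -> R) (a b : 'I_n -> R) :
  (forall i, u i x @[x --> F] --> a i) -> (forall i, v i x @[x --> F] --> b i) ->
  (\sum_(i < n) c i * (u i x - v i x)) ^+ 2 @[x --> F] -->
  (\sum_(i < n) c i * (a i - b i)) ^+ 2.
Proof.
move=> ua vb.
apply: (@cvg_comp _ _ _ (fun x => \sum_(i < n) c i * (u i x - v i x))
  (fun y => y ^+ 2) F (nbhs (\sum_(i < n) c i * (a i - b i)))).
  apply: (@cvg_big _ _ +%R 0 xpredT (@add_continuous R)) => i _.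
  by apply: cvgM; [exact: cvg_cst|exact: cvgB].
exact: exprn_continuous.
Qed.

(** * Compactness of the ball, pointwise and then in norm *)

Section Compactness.
Context {R : realType}.
Local Notation I := (I01 R).
Variables (H C : R).
Hypotheses (H01 : 0 < H < 1 / 2) (C0 : 0 <= C).

Let ball : set {ptws I -> R} := cm_ball H C.

(** Each defining condition is closed because it is a weak inequality or an equation between
    continuous functions of finitely many evaluations. *)
Lemma closed_cm_ball : closed ball.
Proof.
have cproj (t : I) : continuous (fun f : {ptws I -> R} => f t).
  exact: (@proj_continuous _ (fun _ : I => R) t).
have sub (D : set {ptws I -> R}) : closed D -> ball `<=` D -> closure ball `<=` D.
  by move=> cD bD; rewrite [D](closure_id _).1//; exact: closureS.
move=> f clf; split.
  apply: (sub [set f | f (I01_0 R) = 0]) clf; last by move=> g [].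
  rewrite (_ : [set _ | _] = (fun f : {ptws I -> R} => f (I01_0 R)) @^-1` [set 0])//.
  apply: preimage_closed; last exact: closed_eq.
  by move=> g _; exact: cproj.
move=> n c s t.
set q := (X in _ <= X).
apply: (sub [set f | (\sum_(i < n) c i * (f (t i) - f (s i))) ^+ 2 <= q]) clf; last first.
  by move=> g [_]; exact.
rewrite (_ : [set _ | _] = (fun f : {ptws I -> R} =>
    (\sum_(i < n) c i * (f (t i) - f (s i))) ^+ 2) @^-1` [set x | x <= q])//.
apply: preimage_closed; last exact: closed_le.
move=> g _.
exact: (@cvg_sum_incr_sqr R {ptws I -> R} (nbhs g) (nbhs_filter g) n c
  (fun i f => f (t i)) (fun i f => f (s i)) (fun i => g (t i)) (fun i => g (s i))
  (fun i => cproj (t i) g) (fun i => cproj (s i) g)).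
Qed.

(** A closed subset of the product of the intervals [-C, C], compact by Tychonoff. *)
Lemma compact_cm_ball : compact ball.
Proof.
have cB : compact [set f : {ptws I -> R} | forall t, `[- C, C]%classic (f t)].
  have tych := @tychonoff _ (fun _ : I => R) (fun=> `[- C, C]%classic).
  by apply: tych => t; exact: segment_compact.
apply: (subclosed_compact closed_cm_ball cB).
move=> f hf t /=; rewrite in_itv/= -ler_norml.
by have := cm_ball_bound H01 C0 hf (I01_0 R) t; rewrite hf.1 subr0.
Qed.

Variable d : R.
Hypotheses (d0 : 1 / 2 < d) (dH : d < H + 1 / 2).
Local Notation W := (W0 d (lt1_2 R)).

Let d01 : 0 < 2 * d - 2 * H < 1.
Proof. by have /andP[? ?] := H01; move: d0 dH => *; lra. Qed.

Lemma cm_ball_W0_pred (h : I -> R) : cm_ball H C h -> h \in W0_pred d (lt1_2 R).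
Proof. by move=> hC; rewrite /W0_pred inE; exact: cm_ball_W0 hC. Qed.

(** Total map with default value 0 outside [W0]; on the ball it is the identity. *)
Definition to_W0 (h : I -> R) : W := insubd 0 h.

Lemma to_W0K h : cm_ball H C h -> to_W0 h = h :> (I -> R).
Proof. by move=> hC; exact: (insubdK _ (cm_ball_W0_pred hC)). Qed.

(** For f and g in the ball, f - g lies in the ball of radius 2C, where smallness at finitely many
    grid points implies uniform smallness, hence smallness in W^{d,2}. *)
Lemma continuous_to_W0 : {within ball, continuous (to_W0 : {ptws I -> R} -> W)}.
Proof.
apply/subspace_continuousP => f hf; apply/cvgrPdist_lt => eps eps0.
have C20 : 0 <= 2 * C by rewrite mulr_ge0.
have /andP[H0 H1] := H01.
have dd : 0 < d < H + 1 / 2 by move: d0 dH => *; lra.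
have Hd : H < d by move: d0 => *; lra.
have [r r0 hr] := cm_ball_W_norm_lt H01 C20 dd Hd eps0.
have [N hN] := cm_ball_grid_le H01 C20 r0.
(* Finitely many values are constrained, so this is a neighbourhood of f for pointwise
   convergence. *)
have : \forall g \near (f : {ptws I -> R}), forall i : 'I_N.+2,
    `|f (grid N.+1 i) - g (grid N.+1 i)| < r / 2.
  apply: (@filter_forall _ _ (fun (i : 'I_N.+2) (g : {ptws I -> R}) =>
    `|f (grid N.+1 i) - g (grid N.+1 i)| < r / 2) _ (nbhs_filter f)) => i.
  have := @proj_continuous _ (fun _ : I => R) (grid N.+1 i) f.
  move=> /(@cvgrPdist_lt _ _ {ptws I -> R} (nbhs f) (nbhs_filter f)); apply.
  by rewrite divr_gt0.
move=> near_f; rewrite near_withinE.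
apply: (@filterS {ptws I -> R} (nbhs f) (nbhs_filter f) _ _ _ near_f) => g fg hg.
have hfg := cm_ballB hf hg.
rewrite -lte_fin W0_normrE.
rewrite [X in W_norm _ _ X](_ : _ = f - g); last by rewrite /= !to_W0K.
apply: hr => //; apply: hN => // i.
by rewrite !fctE ltW.
Qed.

Lemma compact_W0_cm_ball : compact (to_W0 @` ball).
Proof. exact: continuous_compact continuous_to_W0 compact_cm_ball. Qed.

End Compactness.

(* MathComp-Analysis *)
Theorem theorem3 (R : realType) (H delta : R) (E : rkhs (@fbm_cov R H)) :
  0 < H -> H < 1 / 2 -> 1 / 2 < delta -> delta < H + 1 / 2 ->
  compactly_embedded (U := E) (V := W0 delta (lt1_2 R))
    (@rkhs_eval R _ _ E) (@W0_fun R delta 2 (lt1_2 R)).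
Proof.
move=> H0 H1 d0 dH.
have H01 : 0 < H < 1 / 2 by rewrite H0.
pose i (x : E) : W0 delta (lt1_2 R) := to_W0 delta (rkhs_eval E x).
have iE x : W0_fun (i x) = rkhs_eval E x.
  (* Every x lies in the ball of radius |x|, so the default value never occurs. *)
  by apply: (to_W0K H01 (normr_ge0 x)) => //; exact: cm_ball_rkhs.
have i_lin : linear i.
  move=> a x y; apply: val_inj.
  by rewrite [LHS]iE linearP/= -!iE.
pose iL := GRing.isLinear.Build _ _ _ _ i i_lin.
pose iLin : {linear E -> W0 delta (lt1_2 R)} := HB.pack i iL.
exists iLin; split; first exact: iE.
move=> A /pinfty_ex_gt0[C C0 AC].
have cK := compact_W0_cm_ball H01 (ltW C0) d0 dH.
(* A compact set is closed in the Hausdorff norm topology, hence precompact, and so is the image of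
   [A] inside it. *)
have clK : closed (to_W0 delta @` cm_ball H C).
  by apply: compact_closed cK; exact: norm_hausdorff.
have pK : precompact (to_W0 delta @` cm_ball H C) by rewrite precompact_closed.
apply: precompact_subset pK.
move=> _ [x Ax <-]; exists (rkhs_eval E x) => //.
by apply: cm_ball_rkhs => //; exact: AC.
Qed.
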